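(* There exists a one-pass deterministic streaming algorithm that outputs an $\epsilon$-additive solution to the GEOMETRIC-DISCREPANCY problem using $O\left(\frac{1}{\epsilon}\right)$ space, where $\epsilon\in(0,1)$ is an input parameter.
   Context: GEOMETRIC-DISCREPANCY: given a stream $\mathcal{P}$ of $n$ points in $[0,1]$, report the 1-dimensional geometric discrepancy $$D_g(\mathcal{P}) := \sup_{[p,q]\subseteq[0,1]} \left| \, |[p,q]| - \frac{n_{pq}}{n}\right|,$$ where $|[p,q]|$ is the length of the interval $[p,q]$ and $n_{pq}$ is the number of points of $\mathcal{P}$ in $[p,q]$. An $\epsilon$-additive solution is an output $D'$ with $|D'-D_g(\mathcal{P})| \le \epsilon$. A one-pass (insertion-only) streaming algorithm reads the points once in order and keeps only a sketch in memory. Space is counted in words, where a word can hold a point, any input parameter, and a $\lceil \log n\rceil$-bit counter. *)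

(* Defs.v *)
From mathcomp Require Import all_boot all_order all_algebra.
From mathcomp Require Import classical_sets reals.

Set Implicit Arguments.
Unset Strict Implicit.
Unset Printing Implicit Defensive.

Import Order.TTheory GRing.Theory Num.Theory.
Local Open Scope ring_scope.

(* A stream is a sequence of points: repeated points are counted with
   multiplicity, and degenerate intervals [p, p] are allowed. *)
Definition geometric_discrepancy (R : realType) (P : seq R) : R :=
  sup [set d : R | exists p q : R, [/\ 0 <= p, p <= q, q <= 1 &
    d = `|(q - p) -
          (count (fun x => (p <= x) && (x <= q)) P)%:R / (size P)%:R|]]%classic.

(* Streaming algorithms are programs for a random access machine whose memory
   is a fixed number of words. The instructions only copy real numbers from
   word to word, so that a real word always contains the input parameter or a
   point already read: no information can be packed into a real number. Real
   arithmetic is available in tests and in the final answer, but its results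
   are never written to memory. *)

Variant word (R : Type) : Type := Val of R | Ctr of nat.
Arguments Ctr {R} _.

(* [Ind i] designates the word whose address is the content of word [i]. *)
Variant addr : Type := Dir of nat | Ind of nat.

Inductive nexp : Type :=
| NLit of nat
| NGet of addr
| NAdd of nexp & nexp
| NSub of nexp & nexp
| NMul of nexp & nexp.

Inductive rexp : Type :=
| RLit of nat
| RGet of addr
| RAdd of rexp & rexp
| RSub of rexp & rexp
| RMul of rexp & rexp
| RDiv of rexp & rexp
| RAbs of rexp.

(* [If s t c1 c2] and [While s t c] test whether [s <= t]. *)
Inductive cmd : Type :=
| Skip
| Move of addr & addr
| Calc of addr & nexp
| Seq of cmd & cmd
| If of rexp & rexp & cmd & cmd
| While of rexp & rexp & cmd.

(* [init] is run before the first point is read, [step] after each point has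
   been read, and [final] at the end of the stream; the answer is the value of
   [answer]. *)
Record stream_program : Type := StreamProgram {
  init : cmd;
  step : cmd;
  final : cmd;
  answer : rexp
}.

Section Semantics.
Variable R : realType.
(* The length of the whole stream. Programs have no access to it: it only
   determines the size of a word. *)
Variable n : nat.

Local Notation mem := (seq (word R)).

(* Integer words are (ceil (log2 n))-bit counters or addresses into the memory,
   which consists of S words. *)
Definition fits (S : nat) (w : word R) : bool :=
  match w with
  | Val _ => true
  | Ctr k => ((k < 2 ^ up_log 2 n) || (k < S))%N
  end.

Definition loc (m : mem) (a : addr) : option nat :=
  match a with
  | Dir i => Some i
  | Ind i => if onth m i is Some (Ctr k) then Some k else None
  end.

Definition fetch (m : mem) (a : addr) : option (word R) :=
  if loc m a is Some i then onth m i else None.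

(* [None] is a crash: address out of range, or overflow of a word. *)
Definition store (m : mem) (a : addr) (w : word R) : option mem :=
  if loc m a is Some i then
    if ((i < size m)%N && fits (size m) w) then Some (set_nth w m i w) else None
  else None.

Definition olift2 (A B : Type) (f : A -> A -> B) (x y : option A) : option B :=
  if x is Some a then if y is Some b then Some (f a b) else None else None.

Fixpoint neval (m : mem) (e : nexp) : option nat :=
  match e with
  | NLit k => Some k
  | NGet a => if fetch m a is Some (Ctr k) then Some k else None
  | NAdd e1 e2 => olift2 addn (neval m e1) (neval m e2)
  | NSub e1 e2 => olift2 subn (neval m e1) (neval m e2)
  | NMul e1 e2 => olift2 muln (neval m e1) (neval m e2)
  end.

Fixpoint reval (m : mem) (e : rexp) : option R :=
  match e with
  | RLit k => Some k%:R
  | RGet a => match fetch m a with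
              | Some (Val x) => Some x
              | Some (Ctr k) => Some k%:R
              | None => None
              end
  | RAdd e1 e2 => olift2 (fun x y => x + y) (reval m e1) (reval m e2)
  | RSub e1 e2 => olift2 (fun x y => x - y) (reval m e1) (reval m e2)
  | RMul e1 e2 => olift2 (fun x y => x * y) (reval m e1) (reval m e2)
  | RDiv e1 e2 => if reval m e2 == Some 0 then None
                  else olift2 (fun x y => x / y) (reval m e1) (reval m e2)
  | RAbs e1 => omap (fun x => `|x|) (reval m e1)
  end.

Definition test (m : mem) (s t : rexp) : option bool :=
  olift2 (fun x y => x <= y) (reval m s) (reval m t).

(* Big-step semantics: [exec c m m'] means that [c], started in memory [m],
   terminates without crash in memory [m']. *)
Inductive exec : cmd -> mem -> mem -> Prop :=
| exec_skip m : exec Skip m m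
| exec_move a b w m m' :
    fetch m b = Some w -> store m a w = Some m' -> exec (Move a b) m m'
| exec_calc a e k m m' :
    neval m e = Some k -> store m a (Ctr k) = Some m' -> exec (Calc a e) m m'
| exec_seq c1 c2 m m1 m2 :
    exec c1 m m1 -> exec c2 m1 m2 -> exec (Seq c1 c2) m m2
| exec_if s t c1 c2 b m m' :
    test m s t = Some b -> exec (if b then c1 else c2) m m' ->
    exec (If s t c1 c2) m m'
| exec_while_false s t c m :
    test m s t = Some false -> exec (While s t c) m m
| exec_while_true s t c m m1 m2 :
    test m s t = Some true -> exec c m m1 -> exec (While s t c) m1 m2 ->
    exec (While s t c) m m2.

(* Each point is placed in word 1, overwriting its previous content, so it is
   lost after the next point arrives unless the program has copied it. *)
Inductive feed (c : cmd) : seq R -> mem -> mem -> Prop :=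
| feed_nil m : feed c [::] m m
| feed_cons x P m m1 m2 m3 :
    store m (Dir 1) (Val x) = Some m1 -> exec c m1 m2 -> feed c P m2 m3 ->
    feed c (x :: P) m m3.

End Semantics.

(* [outputs A S eps P d]: on a machine with [S] words, initially all zero except
   word 0 that contains the input parameter [eps], the program [A] reads the
   stream [P] once and answers [d]. *)
Definition outputs (R : realType) (A : stream_program) (S : nat) (eps : R)
    (P : seq R) (d : R) : Prop :=
  exists m0 m1 m2 m3 : seq (word R),
    [/\ store (size P) (nseq S (Ctr 0)) (Dir 0) (Val eps) = Some m0,
        exec (size P) (init A) m0 m1,
        feed (size P) (step A) P m1 m2,
        exec (size P) (final A) m2 m3
      & reval m3 (answer A) = Some d].

Lemma exec_det (R : realType) (n : nat) (c : cmd) (m m1 m2 : seq (word R)) :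
  exec n c m m1 -> exec n c m m2 -> m1 = m2.
Proof.
move=> H; elim: H m2 => {c m m1}.
- by move=> m m2 H; inversion H.
- by move=> a b w m m' Hf Hs m2 H; inversion H; congruence.
- by move=> a e k m m' Hf Hs m2 H; inversion H; congruence.
- move=> c1 c2 m m1 m2 _ IH1 _ IH2 m3 H.
  inversion H as [| | |? ? ? m1' ? E1 E2| | |]; subst.
  by apply: IH2; rewrite (IH1 _ E1).
- move=> s t c1 c2 b m m' Ht _ IH m2 H.
  inversion H as [| | | |? ? ? ? b' ? ? Ht' E| |]; subst.
  by apply: IH; move: Ht' E; rewrite Ht => -[->].
- by move=> s t c m Ht m2 H; inversion H => //; congruence.
- move=> s t c m m1 m2 Ht _ IH1 _ IH2 m3 H.
  inversion H as [| | | | | |? ? ? ? m1' ? Ht' E1 E2]; subst; first congruence.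
  by apply: IH2; rewrite (IH1 _ E1).
Qed.

Lemma feed_det (R : realType) (n : nat) (c : cmd) (P : seq R)
    (m m1 m2 : seq (word R)) :
  feed n c P m m1 -> feed n c P m m2 -> m1 = m2.
Proof.
move=> H; elim: H m2 => {P m m1} [m|x P m m1 m2 m3 Hs He _ IH] m' H.
  by inversion H.
inversion H as [|? ? ? k1 k2 ? Ks Ke Kf]; subst.
apply: IH; move: Ks; rewrite Hs => -[e]; subst k1.
by rewrite (exec_det He Ke).
Qed.

Lemma outputs_det (R : realType) (A : stream_program) (S : nat) (eps : R)
    (P : seq R) (d d' : R) :
  outputs A S eps P d -> outputs A S eps P d' -> d = d'.
Proof.
move=> [m0 [m1 [m2 [m3 [H0 H1 H2 H3 H4]]]]] [k0 [k1 [k2 [k3 [K0 K1 K2 K3 K4]]]]].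
move: K0; rewrite H0 => -[e]; subst k0.
rewrite -(exec_det H1 K1) in K2; rewrite -(feed_det H2 K2) in K3.
by move: K4; rewrite -(exec_det H3 K3) H4 => -[].
Qed.

(* Main.v *)
(** Fix K ~ 4/eps and keep, for each i <= K, the number a_i of points x < i/K.
    Up to O(1/K) and up to a limit at half-open ends, only intervals with
    endpoints on the grid matter, and the signed deviation of [j/K, i/K) is
    g(i) - g(j), where g(i) = i/K - a_i/n. Since j > i is allowed (an overfull
    interval), the discrepancy is max g - min g up to O(1/K), which needs only
    one scan of the counters for two extremal indices.

    A counter need not be able to hold n when n is a power of two. So when the
    number T of counted points reaches K, the next point is not counted, once
    (F = 1): either n <= K and the counters fit as addresses, or all counters
    stay below n and the skipped point costs 1/n < 1/K. *)

Require Import Defs.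
From mathcomp Require Import all_boot all_order all_algebra.
From mathcomp Require Import classical_sets reals.
From mathcomp Require Import zify lra.

Set Implicit Arguments.
Unset Strict Implicit.
Unset Printing Implicit Defensive.

Import Order.TTheory GRing.Theory Num.Theory.
Local Open Scope ring_scope.

(** * The grid program *)

(* Memory: 0 eps, 1 current point, 2 K, 3 T, 4 F, 5 address scanned (downwards
   from 8 + K), 6 and 7 addresses of the maximum and minimum of g, 8 + i the
   counter a_i. *)
Definition scan_loop (body : cmd) : cmd :=
  While (RLit 8) (RGet (Dir 5))
    (Seq body (Calc (Dir 5) (NSub (NGet (Dir 5)) (NLit 1)))).

(** Going downwards, the address ends at 7, which always fits. An upward scan would end at 9 + K,
    the memory size, which may overflow a word when the stream is short. *)
Definition scan (body : cmd) : cmd :=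
  Seq (Calc (Dir 5) (NAdd (NLit 8) (NGet (Dir 2)))) (scan_loop body).

(** The stream length is never stored, since it might overflow: T + F recovers it inside a real
    expression, where word size is no constraint. *)
Definition height (i : nat) : rexp :=
  RSub (RDiv (RSub (RGet (Dir i)) (RLit 8)) (RGet (Dir 2)))
       (RDiv (RGet (Ind i)) (RAdd (RGet (Dir 3)) (RGet (Dir 4)))).

Definition count_point : cmd :=
  If (RSub (RGet (Dir 5)) (RLit 8)) (RMul (RGet (Dir 1)) (RGet (Dir 2)))
    Skip (Calc (Ind 5) (NAdd (NGet (Ind 5)) (NLit 1))).

Definition update_extrema : cmd :=
  Seq (If (height 5) (height 6) Skip (Move (Dir 6) (Dir 5)))
      (If (height 7) (height 5) Skip (Move (Dir 7) (Dir 5))).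

(** The loop of [init] stops at the least K with K eps > 4. The test |T - K| + F <= 0 in [step]
    packs the conjunction of T = K and F = 0 into a single comparison. *)
Definition grid_program : stream_program := {|
  init := While (RMul (RGet (Dir 2)) (RGet (Dir 0))) (RLit 4)
            (Calc (Dir 2) (NAdd (NGet (Dir 2)) (NLit 1)));
  step := If (RAdd (RAbs (RSub (RGet (Dir 3)) (RGet (Dir 2)))) (RGet (Dir 4)))
             (RLit 0)
             (Calc (Dir 4) (NLit 1))
             (Seq (Calc (Dir 3) (NAdd (NGet (Dir 3)) (NLit 1)))
                  (scan count_point));
  final := Seq (Calc (Dir 6) (NLit 8))
             (Seq (Calc (Dir 7) (NLit 8)) (scan update_extrema));
  answer := RSub (height 6) (height 7) |}.

(** * Memory states and stores *)

Definition state (R : realType) (e : R) (w : word R) (K T F p u v : nat)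
    (a : nat -> nat) : seq (word R) :=
  [:: Val e, w, Ctr K, Ctr T, Ctr F, Ctr p, Ctr u, Ctr v
    & mkseq (fun i => Ctr (a i)) K.+1].

Lemma size_state (R : realType) (e : R) (w : word R) (K T F p u v : nat)
    (a : nat -> nat) :
  size (state e w K T F p u v a) = (K + 9)%N.
Proof. by rewrite /= size_map size_iota; lia. Qed.

Lemma fits_ctr (R : realType) (n S k : nat) :
  (k < n)%N || (k < S)%N -> fits n S (@Ctr R k).
Proof.
rewrite /fits; case/orP=> [kn|->]; last by rewrite orbT.
by rewrite (leq_trans kn) // up_logP.
Qed.

Lemma store_ctr (R : realType) (n k i : nat) (m : seq (word R)) (a : addr) :
  loc m a = Some i -> (i < size m)%N -> (k < n)%N || (k < size m)%N ->
  store n m a (Ctr k) = Some (set_nth (Ctr k) m i (Ctr k)).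
Proof. by move=> la im kn; rewrite /store la im fits_ctr. Qed.

Lemma eq_state (R : realType) (e : R) (w : word R) (K T F p u v : nat)
    (a b : nat -> nat) : (forall i, (i <= K)%N -> a i = b i) ->
  state e w K T F p u v a = state e w K T F p u v b.
Proof.
move=> ab; rewrite /state; congr [:: _, _, _, _, _, _, _, _ & _].
by apply/eq_in_map => i; rewrite mem_iota => /andP[_ iK]; rewrite ab.
Qed.

Lemma onth_state (R : realType) (e : R) (w : word R) (K T F p u v j : nat)
    (a : nat -> nat) : (j <= K)%N ->
  onth (state e w K T F p u v a) (8 + j) = Some (Ctr (a j)).
Proof.
by move=> jK; rewrite /= onthE (nth_map (Ctr 0)) ?size_mkseq // nth_mkseq.
Qed.

Lemma set_nth_state (R : realType) (e : R) (w w0 : word R)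
    (K T F p u v j k : nat) (a : nat -> nat) : (j <= K)%N ->
  set_nth w0 (state e w K T F p u v a) (8 + j) (Ctr k) =
  state e w K T F p u v (fun i => if i == j then k else a i).
Proof.
move=> jK; rewrite /state; congr [:: _, _, _, _, _, _, _, _ & _].
apply: (@eq_from_nth _ w0).
  by rewrite size_set_nth !size_mkseq; lia.
move=> i; rewrite size_set_nth size_mkseq => iK.
by rewrite nth_set_nth /= !nth_mkseq; [case: eqP| lia|lia].
Qed.

(** * Execution of the program *)

Lemma exec_scan_loop (R : realType) (n : nat) (body : cmd)
    (I : nat -> seq (word R) -> Prop) :
  (forall j m, I j m -> onth m 5 = Some (Ctr (7 + j))) ->
  (forall j m, I j.+1 m -> exists2 m',
     exec n (Seq body (Calc (Dir 5) (NSub (NGet (Dir 5)) (NLit 1)))) m m' &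
     I j m') ->
  forall j m, I j m -> exists2 m', exec n (scan_loop body) m m' & I 0%N m'.
Proof.
(* Here j is the number of cells left to scan: word 5 holds 7 + j, so the loop exits exactly at j =
   0. *)
move=> I5 Istep; elim=> [|j IH] m Im.
  exists m => //; apply: exec_while_false.
  by rewrite /test /reval /fetch /loc (I5 _ _ Im) /= ler_nat.
have [m1 e1 I1] := Istep _ _ Im; have [m2 e2 I2] := IH _ I1.
exists m2 => //; apply: (exec_while_true _ e1 e2).
by rewrite /test /reval /fetch /loc (I5 _ _ Im) /= ler_nat; congr Some; lia.
Qed.

Lemma exec_count_point (R : realType) (n : nat) (e x : R)
    (K T F p u v : nat) (a : nat -> nat) :
  (forall i, (i <= K)%N -> ((a i).+1 < n) || ((a i).+1 < K + 9))%N ->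
  exec n (scan count_point) (state e (Val x) K T F p u v a)
    (state e (Val x) K T F 7 u v (fun i => a i + (x * K%:R < i%:R)%R)%N).
Proof.
move=> afit.
(* Counters when exactly the cells of index at least j have been updated. *)
pose b j i := (a i + ((j <= i) && (x * K%:R < i%:R)%R))%N.
pose I j (m : seq (word R)) :=
  (j <= K.+1)%N /\ m = state e (Val x) K T F (7 + j) u v (b j).
have [|||m' em' [_ m'E]] := @exec_scan_loop R n count_point I _ _ K.+1
  (state e (Val x) K T F (7 + K.+1) u v a).
- by move=> j m [_ ->].
- move=> j m [jK ->].
  exists (state e (Val x) K T F (7 + j) u v (b j)); last by split=> //; lia.
  apply: (@exec_seq _ _ _ _ _ (state e (Val x) K T F (7 + j.+1) u v (b j))).
    apply: (@exec_if _ _ _ _ _ _ (j%:R <= x * K%:R)).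
      rewrite /test /= /fetch /= addnS -addSn natrD addrC addKr //.
    case: leP => xj.
      rewrite (@eq_state _ _ _ _ _ _ _ _ _ (b j.+1) (b j)); first exact: exec_skip.
      move=> i _; rewrite /b; case: (ltngtP j i) => // <-.
      by rewrite ltNge xj.
    have bj : b j.+1 j = a j by rewrite /b ltnn addn0.
    have E : fetch (state e (Val x) K T F (7 + j.+1) u v (b j.+1)) (Ind 5)
        = Some (Ctr (a j)).
      by rewrite /fetch (_ : loc _ _ = Some (8 + j)%N) ?onth_state ?bj.
    apply: (@exec_calc _ _ _ _ (a j).+1).
      by rewrite /neval E /= addn1.
    rewrite (@store_ctr _ _ _ (8 + j)) ?size_state ?afit //; last lia.
    rewrite set_nth_state //.
    congr Some; apply: eq_state => i iK; rewrite /b.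
    case: eqP => [->|/eqP ij]; first by rewrite leqnn xj addn1.
    by congr (_ + (_ && _))%N; lia.
  apply: (@exec_calc _ _ _ _ (7 + j)%N).
    by rewrite /= /fetch /=; congr Some; lia.
  by rewrite (@store_ctr _ _ _ 5) ?size_state //; lia.
- by split=> //; apply: eq_state => i iK; rewrite /b ltnNge iK addn0.
apply: exec_seq (_ : exec _ _ (state e (Val x) K T F (7 + K.+1) u v a) _).
  apply: (@exec_calc _ _ _ _ (7 + K.+1)%N).
    by rewrite /= /fetch /=; congr Some; lia.
  by rewrite (@store_ctr _ _ _ 5) ?size_state //; lia.
by rewrite m'E in em'.
Qed.

Lemma reval_height (R : realType) (e : R) (w : word R) (K T F p u v d i : nat)
    (a : nat -> nat) :
  (0 < K)%N -> (0 < T + F)%N -> (i <= K)%N ->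
  onth (state e w K T F p u v a) d = Some (Ctr (8 + i)) ->
  reval (state e w K T F p u v a) (height d) =
  Some (i%:R / K%:R - (a i)%:R / (T + F)%:R).
Proof.
move=> K0 TF0 iK; set m := state _ _ _ _ _ _ _ _ _ => md.
have fi : fetch m (Ind d) = Some (Ctr (a i)).
  by rewrite /fetch (_ : loc _ _ = Some (8 + i)%N) ?onth_state // /loc md.
have fd : fetch m (Dir d) = Some (Ctr (8 + i)) by [].
rewrite /height /reval fi fd /fetch /= -natrD.
have nz k : (0 < k)%N -> (Some k%:R == Some 0 :> option R) = false.
  by move=> k0; apply/eqP => -[/eqP]; rewrite pnatr_eq0; lia.
by rewrite !nz //= (natrD _ 8) (addrC 8%:R) addrK.
Qed.

Lemma exec_update_extrema (R : realType) (n : nat) (e : R) (w : word R)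
    (K T F p : nat) (a : nat -> nat) (g : nat -> R) :
  (0 < K)%N -> (0 < T + F)%N ->
  (forall i, g i = i%:R / K%:R - (a i)%:R / (T + F)%:R) ->
  exists u v, [/\ (u <= K)%N, (v <= K)%N,
    forall i, (i <= K)%N -> g v <= g i <= g u &
    exec n (scan update_extrema) (state e w K T F p 8 8 a)
      (state e w K T F 7 (8 + u) (8 + v) a)].
Proof.
move=> K0 TF0 gE.
(* The indices u and v are extremal among the scanned cells. At j = K + 1 no cell is scanned yet, so
   the initial choice u = v = 0 is admissible. *)
pose I j (m : seq (word R)) := (j <= K.+1)%N /\ exists u v,
  [/\ (u <= K)%N, (v <= K)%N,
    forall i, (j <= i <= K)%N -> g v <= g i <= g u &
    m = state e w K T F (7 + j) (8 + u) (8 + v) a].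
have [|||m' em' [_ [u [v [uK vK gext m'E]]]]] :=
  @exec_scan_loop R n update_extrema I _ _ K.+1 (state e w K T F (7 + K.+1) 8 8 a).
- by move=> j m [_ [u [v [_ _ _ ->]]]].
- move=> j m [jK [u [v [uK vK gext ->]]]].
  pose u' := if g j <= g u then u else j.
  pose v' := if g v <= g j then v else j.
  exists (state e w K T F (7 + j) (8 + u') (8 + v') a); last first.
    split; first lia.
    exists u', v'; split=> //; [by rewrite /u'; case: ifP | by rewrite /v'; case: ifP |].
    have gu : g j <= g u' /\ g u <= g u'.
      by rewrite /u'; case: (leP (g j) (g u)) => h; split=> //; apply: ltW.
    have gv : g v' <= g j /\ g v' <= g v.
      by rewrite /v'; case: (leP (g v) (g j)) => h; split=> //; apply: ltW.
    move=> i /andP[]; rewrite leq_eqVlt => /orP[/eqP<- _|ji iK]; first by rewrite gv.1 gu.1.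
    have /andP[? ?] : g v <= g i <= g u by apply: gext; rewrite ji.
    by rewrite (le_trans gv.2) // (le_trans _ gu.2).
  have tst k l q r s t p' : (k <= K)%N -> (l <= K)%N ->
      onth (state e w K T F p' s t a) q = Some (Ctr (8 + k)) ->
      onth (state e w K T F p' s t a) r = Some (Ctr (8 + l)) ->
      test (state e w K T F p' s t a) (height q) (height r) = Some (g k <= g l).
    move=> kK lK oq or; rewrite /test (reval_height K0 TF0 kK oq).
    by rewrite (reval_height K0 TF0 lK or) /= -!gE.
  apply: (@exec_seq _ _ _ _ _ (state e w K T F (7 + j.+1) (8 + u') (8 + v') a)).
    apply: (@exec_seq _ _ _ _ _ (state e w K T F (7 + j.+1) (8 + u') (8 + v) a)).
      apply: (exec_if (tst _ _ _ _ _ _ _ _ _ _ _)); [exact: jK | exact: uK |by [] |by [] |].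
      rewrite /u'; case: leP => _; first exact: exec_skip.
      apply: (@exec_move _ _ _ _ (Ctr (8 + j))); first by [].
      by rewrite (@store_ctr _ _ _ 6) ?size_state //; lia.
    apply: (exec_if (tst _ _ _ _ _ _ _ _ _ _ _)); [exact: vK | exact: jK |by [] |by [] |].
    rewrite /v'; case: leP => _; first exact: exec_skip.
    apply: (@exec_move _ _ _ _ (Ctr (8 + j))); first by [].
    by rewrite (@store_ctr _ _ _ 7) ?size_state //; lia.
  apply: (@exec_calc _ _ _ _ (7 + j)%N).
    by rewrite /= /fetch /=; congr Some; lia.
  by rewrite (@store_ctr _ _ _ 5) ?size_state //; lia.
- by split=> //; exists 0%N, 0%N; split=> // i; lia.
exists u, v; split=> //.
apply: exec_seq (_ : exec _ _ (state e w K T F (7 + K.+1) 8 8 a) _).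
  apply: (@exec_calc _ _ _ _ (7 + K.+1)%N).
    by rewrite /= /fetch /=; congr Some; lia.
  by rewrite (@store_ctr _ _ _ 5) ?size_state //; lia.
by rewrite m'E in em'.
Qed.

Lemma exec_init (R : realType) (n K : nat) (e : R) :
  4 < K%:R * e -> (forall k, (k < K)%N -> k%:R * e <= 4) ->
  exists2 m, store n (nseq (K + 9) (Ctr 0)) (Dir 0) (Val e) = Some m &
    exec n (init grid_program) m (state e (Ctr 0) K 0 0 0 0 0 (fun=> 0%N)).
Proof.
move=> K4 ltK4; pose m k : seq (word R) := [:: Val e, Ctr 0, Ctr k & nseq (K + 6) (Ctr 0)].
exists (m 0%N); first by rewrite /m (addnC K 6) (addnC K 9).
have sm k : size (m k) = (K + 9)%N by rewrite /= size_nseq; lia.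
have <- : m K = state e (Ctr 0) K 0 0 0 0 0 (fun=> 0%N).
  rewrite /m (addnC K 6) -[nseq _ _]/[:: Ctr 0, Ctr 0, Ctr 0, Ctr 0, Ctr 0
    & nseq K.+1 (Ctr 0)].
  congr [:: _, _, _, _, _, _, _, _ & _].
  apply: (@eq_from_nth _ (Ctr 0)) => [|i]; rewrite ?size_mkseq size_nseq // => iK.
  by rewrite nth_mkseq // nth_nseq iK.
have tm k : test (m k) (RMul (RGet (Dir 2)) (RGet (Dir 0))) (RLit 4)
  = Some (k%:R * e <= 4) by [].
(* Induction on the number d of remaining increments. *)
suff H d : (d <= K)%N -> exec n (init grid_program) (m (K - d)%N) (m K).
  by have := H K (leqnn _); rewrite subnn.
elim: d => [_|d IH dK].
  by rewrite subn0; apply: exec_while_false; rewrite tm leNgt K4.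
apply: (@exec_while_true _ _ _ _ _ _ (m (K - d)%N)); last exact/IH/ltnW.
  by rewrite tm ltK4 //; lia.
apply: (@exec_calc _ _ _ _ (K - d)%N).
  by rewrite /= /fetch /=; congr Some; lia.
by rewrite (@store_ctr _ _ _ 2) ?sm //; lia.
Qed.

(** Here c i is the true count over the points already read, and a i falls short of it by at most F.
    The bound a i <= T reduces the overflow of every counter to that of T. *)
Lemma feed_step (R : realType) (n K : nat) (e : R) (P : seq R) (w : word R)
    (T F p u v : nat) (a c : nat -> nat) :
  (T + F + size P <= n)%N ->
  (F = 0 /\ T <= K \/ F = 1 /\ K <= T)%N ->
  (forall i, (i <= K)%N -> (a i <= T)%N /\ (a i <= c i <= a i + F)%N) ->
  exists w' T' F' p' a',
    [/\ (T' + F' = T + F + size P)%N,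
      (F' = 0 /\ T' <= K \/ F' = 1 /\ K <= T')%N,
      forall i, (i <= K)%N ->
        (a' i <= c i + count (fun x : R => x * K%:R < i%:R)%R P <= a' i + F')%N &
      feed n (step grid_program) P (state e w K T F p u v a)
        (state e w' K T' F' p' u v a')].
Proof.
elim: P w T F p a c => [|x P IH] w T F p a c.
  move=> _ TF ac; exists w, T, F, p, a; split=> //; [by rewrite addn0| |exact: feed_nil].
  by move=> i /ac[_]; rewrite addn0.
rewrite /= => nT TF ac.
pose c1 i := (c i + (x * K%:R < i%:R)%R)%N.
have [m2 [T1 [F1 [p1 [a1 [m2E sumE TF1 ac1 e1]]]]]] : exists m2 T1 F1 p1 a1,
   [/\ m2 = state e (Val x) K T1 F1 p1 u v a1, (T1 + F1 = (T + F).+1)%N,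
    (F1 = 0 /\ T1 <= K \/ F1 = 1 /\ K <= T1)%N,
    (forall i, (i <= K)%N -> (a1 i <= T1)%N /\ (a1 i <= c1 i <= a1 i + F1)%N) &
    exec n (step grid_program) (state e (Val x) K T F p u v a) m2].
  have tE : test (state e (Val x) K T F p u v a)
     (RAdd (RAbs (RSub (RGet (Dir 3)) (RGet (Dir 2)))) (RGet (Dir 4))) (RLit 0)
     = Some ((T == K) && (F == 0%N)).
    rewrite /test /= /fetch /=; congr Some.
    have [->|TK] := eqVneq T K; first by rewrite subrr normr0 add0r lern0.
    apply/negbTE; rewrite -ltNge ltr_wpDr ?ler0n // normr_gt0 subr_eq0.
    by rewrite eqr_nat.
  case: (boolP ((T == K) && (F == 0%N))) tE => [/andP[/eqP ? /eqP ?] tE|TFK tE].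
    (* The skipped point raises c i by at most one, which the new value F = 1 absorbs. *)
    subst T F; exists (state e (Val x) K K 1 p u v a), K, 1%N, p, a; split=> //.
    - by rewrite addn0 addn1.
    - by right.
    - by move=> i /ac; rewrite /c1; lia.
    apply: (exec_if tE); apply: (@exec_calc _ _ _ _ 1%N); first by [].
    by rewrite (@store_ctr _ _ _ 4) ?size_state //; lia.
  (* If F = 0, then T <= K and T + 1 fits as an address. If F = 1, the skipped point and the current
     one are both among the n points, so T + 2 <= n. *)
  have bnd : ((T.+1 < n) || (T.+1 < K + 9))%N by lia.
  exists (state e (Val x) K T.+1 F 7 u v
            (fun i => a i + (x * K%:R < i%:R)%R)%N), T.+1, F, 7%N,
    (fun i => a i + (x * K%:R < i%:R)%R)%N; split=> //.
  - lia.
  - by move=> i /ac; rewrite /c1; lia.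
  apply: (exec_if tE).
  apply: (@exec_seq _ _ _ _ _ (state e (Val x) K T.+1 F p u v a)).
    apply: (@exec_calc _ _ _ _ T.+1); first by rewrite /= /fetch /= addn1.
    by rewrite (@store_ctr _ _ _ 3) ?size_state //; lia.
  by apply: exec_count_point => i /ac; lia.
subst m2.
have [|w' [T' [F' [p' [a' [h1 h2 h3 h4]]]]]] := IH (Val x) T1 F1 p1 a1 c1 _ TF1 ac1.
  lia.
exists w', T', F', p', a'; split=> //; first lia.
  by move=> i /h3; rewrite /c1; lia.
by apply: (feed_cons _ e1 h4); rewrite /store size_state ifT //= andbT; lia.
Qed.

(** * Discrepancy against grid deviations *)

Lemma count_interval (R : realType) (P : seq R) (p q : R) : p <= q ->
  (count (fun x => x < p)%R P + count (fun x => (p <= x) && (x <= q))%R P =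
   count (fun x => x <= q)%R P)%N.
Proof.
move=> pq; elim: P => //= x P <-.
rewrite addnACA; congr (_ + _)%N.
by case: (ltP x p) => //= xp; rewrite (le_trans (ltW xp) pq).
Qed.

Section GridEstimate.
Variables (R : realType) (P : seq R) (K : nat).
Hypothesis P_gt0 : (0 < size P)%N.
Hypothesis K_gt0 : (0 < K)%N.

Let n : R := (size P)%:R.
Let below (i : nat) := count (fun x : R => x * K%:R < i%:R)%R P.
Let h (i : nat) : R := i%:R / K%:R - (below i)%:R / n.

Let n_gt0 : 0 < n. Proof. by rewrite ltr0n. Qed.
Let KR_gt0 : 0 < K%:R :> R. Proof. by rewrite ltr0n. Qed.

Lemma has_sup_discrepancy :
  has_sup [set d : R | exists p q : R, [/\ 0 <= p, p <= q, q <= 1 &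
    d = `|(q - p) -
          (count (fun x => (p <= x) && (x <= q)) P)%:R / (size P)%:R|]]%classic.
Proof.
split; first by eexists; exists 0, 0; split=> //; rewrite ler01.
exists 2 => _ [p [q [p0 pq q1 ->]]].
set c := count _ _.
have c0 : 0 <= c%:R / (size P)%:R :> R by rewrite divr_ge0 ?ler0n.
have c1 : c%:R / (size P)%:R <= 1 :> R.
  by rewrite ler_pdivrMr ?mul1r ?ler_nat ?count_size // ltr0n.
by rewrite ler_norml; apply/andP; split; lra.
Qed.

Lemma le_discrepancy (p q : R) : 0 <= p -> p <= q -> q <= 1 ->
  `|(q - p) - (count (fun x => (p <= x) && (x <= q)) P)%:R / n|
  <= geometric_discrepancy P.
Proof.
move=> p0 pq q1; apply: (sup_upper_bound has_sup_discrepancy).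
by exists p, q.
Qed.

(** The predicate s covers both [x < t] and [x <= t], as needed at the two ends of a closed
    interval. If t lies in [i/K, (i+1)/K), monotonicity of counts bounds its deviation above by h i
    + 1/K and below by h (i+1) - 1/K. *)
Lemma local_deviation_bounds (s : pred R) (t lo hi : R) :
  (forall i, (i <= K)%N -> lo <= h i <= hi) -> 0 <= t <= 1 ->
  (forall x, x < t -> s x) -> (forall x, s x -> x <= t) ->
  lo - K%:R^-1 <= t - (count s P)%:R / n <= hi + K%:R^-1.
Proof.
move=> hb /andP[t0 t1] ts st.
have Kinv : 0 < K%:R^-1 :> R by rewrite invr_gt0.
have le_cnt (a b : nat) : (a <= b)%N -> a%:R / n <= b%:R / n :> R.
  by move=> ab; rewrite ler_pM2r ?invr_gt0 // ler_nat.
pose i := Num.truncn (t * K%:R).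
have tK0 : 0 <= t * K%:R by rewrite mulr_ge0 ?ler0n.
have /andP[i_le i_gt] := truncn_itv tK0; rewrite -/i in i_le i_gt.
have iK : (i <= K)%N.
  by rewrite -(ler_nat R) (le_trans i_le) // ler_piMl ?ler0n.
have i_le' : i%:R / K%:R <= t by rewrite ler_pdivrMr.
have i_gt' : t < i%:R / K%:R + K%:R^-1.
  by rewrite -[X in _ + X]mul1r -mulrDl natr1 ltr_pdivlMr.
apply/andP; split; last first.
  have /andP[_ hi_i] := hb _ iK.
  have : (below i)%:R / n <= (count s P)%:R / n :> R.
    apply/le_cnt/sub_count => x; rewrite /= => xi; apply: ts.
    by rewrite -(ltr_pM2r KR_gt0) (lt_le_trans xi).
  by rewrite /h in hi_i; lra.
(* At t = 1 the counter i + 1 does not exist, but the deviation is >= 0 >= h 0. *)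
have [t_lt1|t_ge1] := ltP t 1; last first.
  have h0 : h 0 <= 0.
    by rewrite /h mul0r sub0r oppr_le0 divr_ge0 ?ler0n.
  have /andP[lo0 _] := hb 0%N (leq0n _).
  have : (count s P)%:R / n <= 1 by rewrite ler_pdivrMr ?mul1r ?ler_nat ?count_size.
  by lra.
have i1K : (i.+1 <= K)%N.
  by rewrite -(ltr_nat R) (le_lt_trans i_le) // gtr_pMl.
have /andP[lo_i _] := hb _ i1K.
have : (count s P)%:R / n <= (below i.+1)%:R / n :> R.
  apply/le_cnt/sub_count => x /st xt /=.
  by rewrite (le_lt_trans _ i_gt) // ler_pM2r.
rewrite /h -natr1 mulrDl mul1r in lo_i; lra.
Qed.

(** By [count_interval], the signed deviation of [p, q] is the prefix deviation at q minus the one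
    at p (with p excluded), and each is within 1/K of the range [lo, hi]. *)
Lemma discrepancy_le_grid (lo hi : R) :
  (forall i, (i <= K)%N -> lo <= h i <= hi) ->
  geometric_discrepancy P <= hi - lo + 2 / K%:R.
Proof.
move=> hb; apply: ge_sup; first by case: has_sup_discrepancy.
move=> _ [p [q [p0 pq q1 ->]]]; rewrite -/n.
have /andP[pl ph] : lo - K%:R^-1
    <= p - (count (fun x => x < p) P)%:R / n <= hi + K%:R^-1.
  by apply: local_deviation_bounds => //; [rewrite p0 (le_trans pq)|move=> x /ltW].
have /andP[ql qh] : lo - K%:R^-1
    <= q - (count (fun x => x <= q) P)%:R / n <= hi + K%:R^-1.
  by apply: local_deviation_bounds => //; [rewrite q1 (le_trans p0)|move=> x /ltW].
rewrite -(count_interval P pq) natrD mulrDl in ql qh.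
by rewrite ler_norml; apply/andP; split; lra.
Qed.

(** For u <= v the relevant interval is overfull, and closing [u/K, v/K) only adds points, at no
    cost. For v < u it is underfull, and shrinking it to a closed interval costs length 1/K. *)
Lemma grid_le_discrepancy (u v : nat) : (u <= K)%N -> (v <= K)%N ->
  h u - h v <= geometric_discrepancy P + K%:R^-1.
Proof.
move=> uK vK; have Kinv : 0 < K%:R^-1 :> R by rewrite invr_gt0.
have grid0 i : 0 <= i%:R / K%:R :> R by rewrite divr_ge0 ?ler0n.
have grid1 i : (i <= K)%N -> i%:R / K%:R <= 1 :> R.
  by move=> iK; rewrite ler_pdivrMr ?mul1r ?ler_nat.
have gridS i j : (i <= j)%N -> i%:R / K%:R <= j%:R / K%:R :> R.
  by move=> ij; rewrite ler_pM2r ?invr_gt0 // ler_nat.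
have belowE i : below i = count (fun x => x < i%:R / K%:R) P.
  by apply: eq_count => x /=; rewrite ltr_pdivlMr.
have [uv|vu] := leqP u v.
  have := le_discrepancy (grid0 u) (gridS _ _ uv) (grid1 _ vK).
  have : (below v)%:R / n <= (count (fun x => x <= v%:R / K%:R) P)%:R / n :> R.
    rewrite ler_pM2r ?invr_gt0 // ler_nat belowE.
    by apply: sub_count => x /= /ltW.
  rewrite -(count_interval P (gridS _ _ uv)) natrD mulrDl -belowE.
  by rewrite ler_norml /h => ? /andP[? _]; lra.
(* [v/K, (u+1)/K) is half-open: use the closed interval [v/K, u/K] instead. *)
case: u uK vu => // u uK; rewrite ltnS => vu.
have := le_discrepancy (grid0 v) (gridS _ _ vu) (grid1 _ (ltnW uK)).
have : (count (fun x => x <= u%:R / K%:R) P)%:R / n <= (below u.+1)%:R / n :> R.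
  rewrite ler_pM2r ?invr_gt0 // ler_nat belowE.
  apply: sub_count => x /= xu; apply: le_lt_trans xu _.
  by rewrite ltr_pM2r ?invr_gt0 // ltr_nat.
rewrite -(count_interval P (gridS _ _ vu)) natrD mulrDl -belowE.
rewrite ler_norml /h -(natr1 u) [(_ + 1) / _]mulrDl mul1r => ? /andP[_ ?]; lra.
Qed.

End GridEstimate.

(** * Choice of K and final error bound *)

Theorem theorem21 (R : realType) :
  exists (A : stream_program) (C : R),
    forall eps : R, 0 < eps -> eps < 1 ->
      exists S : nat,
        S%:R <= C / eps /\
        forall P : seq R,
          (0 < size P)%N -> (forall x, x \in P -> 0 <= x <= 1) ->
          exists D' : R,
            outputs A S eps P D' /\
            `|D' - geometric_discrepancy P| <= eps.
Proof.
(* Minimality of K gives K eps <= 4 + eps, so the K + 9 words satisfy (K + 9) eps <= 4 + 10 eps <=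
   14. *)
exists grid_program, 14 => eps eps_gt0 eps_lt1.
have eps4 : 0 <= 4 / eps by rewrite divr_ge0 // ltW.
pose K := (Num.truncn (4 / eps)).+1.
have /andP[trunc_le K_gt] := truncn_itv eps4; rewrite -/K in K_gt.
have K_eps : 4 < K%:R * eps by rewrite -ltr_pdivrMr.
have K_min k : (k < K)%N -> k%:R * eps <= 4.
  move=> kK; rewrite -ler_pdivlMr //.
  by apply: le_trans trunc_le; rewrite ler_nat -ltnS.
exists (K + 9)%N; split.
  rewrite ler_pdivlMr // natrD mulrDl.
  have := K_min K.-1 (ltnSn _); rewrite -[K]prednK // -[in X in _ -> X]natr1 /=.
  by rewrite mulrDl; lra.
move=> P P_gt0 P01; have K_gt0 : (0 < K)%N by [].
have [m0 m0E init_ok] := exec_init (size P) K_eps K_min.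
pose c i := count (fun x : R => x * K%:R < i%:R) P.
have [|||w [T [F [p [a [TF_size TF ac feed_ok]]]]]] := @feed_step R (size P) K eps P
  (Ctr 0) 0 0 0 0 0 (fun=> 0%N) (fun=> 0%N).
- by [].
- by left.
- by [].
rewrite add0n in TF_size.
pose g i : R := i%:R / K%:R - (a i)%:R / (T + F)%:R.
have TF_gt0 : (0 < T + F)%N by rewrite TF_size.
have [u [v [uK vK gext scan_ok]]] :=
  exec_update_extrema (size P) eps w p K_gt0 TF_gt0 (fun i => erefl (g i)).
exists (g u - g v); split.
  exists m0, (state eps (Ctr 0) K 0 0 0 0 0 (fun=> 0%N)),
    (state eps w K T F p 0 0 a), (state eps w K T F 7 (8 + u) (8 + v) a).
  split=> //; last first.
    rewrite [reval _ _]/(olift2 _ (reval _ (height 6)) (reval _ (height 7))).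
    by rewrite (reval_height K_gt0 TF_gt0 uK) // (reval_height K_gt0 TF_gt0 vK).
  apply: (@exec_seq _ _ _ _ _ (state eps w K T F p 8 0 a)).
    apply: (@exec_calc _ _ _ _ 8); first by [].
    by rewrite (@store_ctr _ _ _ 6) ?size_state //; lia.
  apply: exec_seq scan_ok; apply: (@exec_calc _ _ _ _ 8); first by [].
  by rewrite (@store_ctr _ _ _ 7) ?size_state //; lia.
have n_gt0 : 0 < (size P)%:R :> R by rewrite ltr0n.
have KR_gt0 : 0 < K%:R :> R by rewrite ltr0n.
have Kinv : 0 < K%:R^-1 :> R by rewrite invr_gt0.
pose h i : R := i%:R / K%:R - (c i)%:R / (size P)%:R.
(* The possible undercount costs F/n <= 1/K, because F = 1 forces K <= T < n. *)
have gh i : (i <= K)%N -> h i <= g i <= h i + K%:R^-1.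
  move=> /ac; rewrite add0n -/(c i) => /andP[ac1 ac2].
  have l1 : (a i)%:R / (size P)%:R <= (c i)%:R / (size P)%:R :> R.
    by rewrite ler_pM2r ?invr_gt0 // ler_nat.
  have l2 : (c i)%:R / (size P)%:R <= (a i)%:R / (size P)%:R + F%:R / (size P)%:R :> R.
    by rewrite -mulrDl -natrD ler_pM2r ?invr_gt0 // ler_nat.
  have l3 : F%:R / (size P)%:R <= K%:R^-1 :> R.
    case: TF => [[-> _]|[F1 KT]]; first by rewrite mul0r ltW.
    by rewrite F1 mul1r lef_pV2 ?posrE // ler_nat; lia.
  by rewrite /g /h TF_size; apply/andP; split; lra.
have hext i : (i <= K)%N -> g v - K%:R^-1 <= h i <= g u.
  by move=> iK; have := gext _ iK; have := gh _ iK; lra.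
(* With D the discrepancy, D <= g u - g v + 3/K and g u - g v <= D + 2/K; both errors are below eps
   since 4/K < eps. *)
have D_le := discrepancy_le_grid P_gt0 K_gt0 hext.
have D_ge := grid_le_discrepancy P_gt0 K_gt0 uK vK.
rewrite -/(c u) -/(c v) -/(h u) -/(h v) in D_ge.
have K_eps' : 4 * K%:R^-1 < eps by rewrite ltr_pdivrMr // mulrC.
have := gh _ uK; have := gh _ vK => /andP[? ?] /andP[? ?].
by rewrite ler_norml; apply/andP; split; lra.
Qed.
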